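(* Let $\mathbb{K}$ be a field, $S=\mathbb{K}[x_1,\dots,x_n]$, and let $I\subset S$ be a normal monomial ideal. Then the following statements hold. (i) There exists an integer $k\geq 1$ such that for every integer $s\geq 1$ we have ${\rm sdepth}(I^k)={\rm sdepth}(I^{sk})$. (ii) There exists an integer $k\geq 1$ such that for every integer $s\geq 1$ we have ${\rm sdepth}(S/I^k)={\rm sdepth}(S/I^{sk})$.
   Context: $S=\mathbb{K}[x_1,\dots,x_n]$ is the polynomial ring over a field $\mathbb{K}$ with its standard $\mathbb{Z}^n$-grading ($\deg x_i=e_i$). Stanley depth: let $M$ be a finitely generated $\mathbb{Z}^n$-graded $S$-module. For a homogeneous element $u\in M$ and a subset $Z\subseteq\{x_1,\dots,x_n\}$, let $u\mathbb{K}[Z]$ be the $\mathbb{K}$-subspace of $M$ generated by all elements $uv$ with $v\in\mathbb{K}[Z]$. It is called a Stanley space of dimension $|Z|$ if it is a free $\mathbb{K}[Z]$-module. A Stanley decomposition $\mathcal{D}$ of $M$ is a decomposition of $M$ (as a $\mathbb{K}$-vector space) as a finite direct sum of Stanley spaces. The Stanley depth ${\rm sdepth}(\mathcal{D})$ is the minimum dimension of a Stanley space in $\mathcal{D}$, and ${\rm sdepth}(M)$ is the maximum of ${\rm sdepth}(\mathcal{D})$ over all Stanley decompositions $\mathcal{D}$ of $M$. Convention: ${\rm sdepth}(0)=\infty$ (empty decomposition). Integral closure: for an ideal $I\subseteq S$, an element $f\in S$ is integral over $I$ if there is an equation $f^m+c_1f^{m-1}+\dots+c_{m-1}f+c_m=0$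 with $m\ge 1$ and $c_i\in I^i$. The integral closure $\overline{I}$ is the set of all elements of $S$ integral over $I$. For a monomial ideal $I$, it is known that $\overline{I}$ is the monomial ideal generated by all monomials $u\in S$ such that $u^m\in I^m$ for some integer $m\geq 1$. The ideal $I$ is integrally closed if $I=\overline{I}$, and normal if all powers $I^k$, $k\geq 1$, are integrally closed. *)

(* Defs.v *)
From HB Require Import structures.
From mathcomp Require Import all_boot all_order all_algebra generic_quotient.
From mathcomp Require Import boolp mpoly.

Set Implicit Arguments.
Unset Strict Implicit.
Unset Printing Implicit Defensive.

Import Order.TTheory GRing.Theory Num.Theory.
Local Open Scope ring_scope.
Local Open Scope quotient_scope.

Section Ideals.
Variable R : comNzRingType.
Implicit Types (A : R -> Prop) (I : {pred R}) (f : R) (k : nat).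

Definition ideal_gen A f : Prop :=
  exists2 s : seq (R * R),
    (forall p, p \in s -> A p.2) & f = \sum_(p <- s) p.1 * p.2.

Definition prods_of I k f : Prop :=
  exists2 t : k.-tuple R,
    (forall g, g \in tval t -> g \in I) & f = \prod_(g <- t) g.

(* For k = 0 the only product is 1, so ideal_pow I 0 is the unit ideal. *)
Definition ideal_pow I k : {pred R} := fun f => `[< ideal_gen (prods_of I k) f >].

Definition integral_over I f : Prop :=
  exists (m : nat) (c : nat -> R),
    [/\ (1 <= m)%N,
        (forall i, (1 <= i <= m)%N -> c i \in ideal_pow I i)
      & f ^+ m + \sum_(1 <= i < m.+1) c i * f ^+ (m - i) = 0].

Definition integral_closure I : {pred R} := fun f => `[< integral_over I f >].

Definition integrally_closed I : Prop := I =i integral_closure I.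

Definition normal_ideal I : Prop :=
  forall k, (1 <= k)%N -> integrally_closed (ideal_pow I k).

Lemma ideal_gen0 A : ideal_gen A 0.
Proof. by exists [::]; rewrite ?big_nil. Qed.

Lemma ideal_genD A f g : ideal_gen A f -> ideal_gen A g -> ideal_gen A (f + g).
Proof.
move=> [s hs ->] [t ht ->]; exists (s ++ t); last by rewrite big_cat.
by move=> p; rewrite mem_cat => /orP[/hs|/ht].
Qed.

Lemma ideal_genM A h f : ideal_gen A f -> ideal_gen A (h * f).
Proof.
move=> [s hs ->]; exists [seq (h * p.1, p.2) | p <- s].
  by move=> p /mapP[q /hs hq ->].
by rewrite big_map mulr_sumr; apply: eq_bigr => p _; rewrite mulrA.
Qed.

Lemma ideal_gen_sum A (T : eqType) (s : seq T) (F : T -> R) :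
  (forall x, x \in s -> ideal_gen A (F x)) -> ideal_gen A (\sum_(x <- s) F x).
Proof.
move=> h; rewrite big_seq; apply: (big_ind (ideal_gen A)) => //.
- exact: ideal_gen0.
- by move=> *; apply: ideal_genD.
Qed.

Lemma ideal_gen_mem A f : A f -> ideal_gen A f.
Proof.
move=> Af; exists [:: (1, f)]; last by rewrite big_seq1 mul1r.
by move=> p; rewrite inE => /eqP ->.
Qed.

End Ideals.

Section MonomialIdeals.
Variables (K : fieldType) (n : nat).
Local Notation S := {mpoly K[n]}.

(* S^o is S as a module over itself, so that an ideal is a submodule. *)
Record monomial_ideal := MonomialIdeal {
  mideal_pred :> {pred S^o};
  mideal_gen : exists A : 'X_{1..n} -> Prop,
    forall f : S, f \in mideal_pred <->
      ideal_gen (fun g : S => exists2 m, A m & g = 'X_[m]) f }.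

Implicit Types (I : monomial_ideal) (f g : S) (m : 'X_{1..n}).

Lemma mideal0 I : (0 : S) \in (I : {pred S}).
Proof. by case: (mideal_gen I) => A h; apply/h/ideal_gen0. Qed.

Lemma midealD I f g : f \in (I : {pred S}) -> g \in (I : {pred S}) ->
  f + g \in (I : {pred S}).
Proof.
by case: (mideal_gen I) => A h /h hf /h hg; apply/h; apply: ideal_genD.
Qed.

Lemma midealM I f g : g \in (I : {pred S}) -> f * g \in (I : {pred S}).
Proof. by case: (mideal_gen I) => A h /h hg; apply/h; apply: ideal_genM. Qed.

Lemma mideal_submod_closed I : GRing.subsemimod_closed (mideal_pred I).
Proof.
split; first split; first exact: mideal0.
- by move=> f g; apply: midealD.
- by move=> a f; apply: midealM.
Qed.

Lemma mideal_oppr_closed I : oppr_closed (mideal_pred I).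
Proof. by move=> f hf; rewrite -mulN1r; apply: midealM. Qed.

HB.instance Definition _ I :=
  GRing.isSubmodClosed.Build S S^o (mideal_pred I) (mideal_submod_closed I).
HB.instance Definition _ I :=
  GRing.isOppClosed.Build S^o (mideal_pred I) (@mideal_oppr_closed I).

Lemma monomial_genP (A : 'X_{1..n} -> Prop) f :
  ideal_gen (fun g : S => exists2 m, A m & g = 'X_[m]) f <->
  (forall m, m \in msupp f -> exists a b, A a /\ m = (b + a)%MM).
Proof.
split=> [[s hs ->] m|h].
  move/msupp_sum_le; rewrite filter_predT => /flatten_mapP[p ps].
  have [a Aa ->] := hs _ ps; move/msuppM_le/allpairsP => [[b c] /= [_]].
  by rewrite msuppX inE => /eqP -> ->; exists a, b.
rewrite [f]mpolyE; apply: ideal_gen_sum => m /h[a [b [Aa ->]]].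
rewrite mpolyXD -mul_mpolyC mulrA; apply: ideal_genM; apply: ideal_gen_mem.
by exists a.
Qed.

Lemma midealP I f :
  f \in (I : {pred S}) <->
  (forall m, m \in msupp f -> ('X_[m] : S) \in (I : {pred S})).
Proof.
case: (mideal_gen I) => A hA; split.
  move=> /hA/monomial_genP hf m /hf hm; apply/hA/monomial_genP => m'.
  by rewrite msuppX inE => /eqP ->.
move=> hf; apply/hA/monomial_genP => m /hf/hA/monomial_genP; apply.
by rewrite msuppX inE.
Qed.

Lemma mideal_pow_gen I k : exists A : 'X_{1..n} -> Prop,
  forall f : S, f \in (ideal_pow I k : {pred S^o}) <->
    ideal_gen (fun g : S => exists2 m, A m & g = 'X_[m]) f.
Proof.
exists (fun m => ideal_gen (prods_of (I : {pred S}) k) ('X_[m] : S)) => f.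
split; last first.
  case=> s hs ->; apply/asboolP; apply: ideal_gen_sum => p /hs[m hm ->].
  exact: ideal_genM.
have key (t : seq S) : (forall g, g \in t -> g \in (I : {pred S})) ->
  forall m, m \in msupp (\prod_(g <- t) g) ->
  exists2 u : seq S, size u = size t &
    (forall g, g \in u -> g \in (I : {pred S})) /\ 'X_[m] = \prod_(g <- u) g.
  elim: t => [_ m|g t IH ht m].
    rewrite big_nil msupp1 inE => /eqP ->; exists [::] => //; split=> //.
    by rewrite big_nil mpolyX0.
  rewrite big_cons => /msuppM_le/allpairsP[[a b] /= [ha hb ->]].
  have [|u su [hu eu]] := IH _ b hb.
    by move=> h hh; apply: ht; rewrite inE hh orbT.
  exists ('X_[a] :: u); rewrite /= ?su //; split.
    move=> h; rewrite inE => /orP[/eqP ->|/hu //].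
    by have /midealP := ht g (mem_head _ _); apply.
  by rewrite big_cons -eu mpolyXD.
move=> /asboolP[s hs ->]; apply: ideal_gen_sum => p /hs[t ht ->].
apply: ideal_genM; rewrite [\prod_(g <- t) g]mpolyE.
apply: ideal_gen_sum => m /(key _ ht)[u su [hu eu]].
rewrite -mul_mpolyC; apply: ideal_genM; apply: ideal_gen_mem.
exists m => //; apply: ideal_gen_mem.
have sz : size u == k by rewrite su size_tuple.
by exists (Tuple sz).
Qed.

Definition mideal_pow I k : monomial_ideal :=
  @MonomialIdeal (ideal_pow I k) (mideal_pow_gen I k).

End MonomialIdeals.

Section GradedModules.
Variables (K : fieldType) (n : nat).
Local Notation S := {mpoly K[n]}.

Definition mnm_deg (m : 'X_{1..n}) : 'rV[int]_n := \row_i (m i)%:Z.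

(* K acts on an S-module through the constant polynomials. *)
Record graded_module := GradedModule {
  gm_sort :> lmodType S;
  gm_comp : 'rV[int]_n -> gm_sort -> Prop;
  gm_comp0 : forall a, gm_comp a 0;
  gm_compD : forall a u v, gm_comp a u -> gm_comp a v -> gm_comp a (u + v);
  gm_compZ : forall a (c : K) u, gm_comp a u -> gm_comp a (c%:MP *: u);
  gm_compX : forall a m u,
    gm_comp a u -> gm_comp (mnm_deg m + a) (('X_[m] : S) *: u);
  gm_span : forall x, exists (s : seq 'rV[int]_n) (u : 'rV[int]_n -> gm_sort),
    [/\ uniq s, forall a, gm_comp a (u a) & x = \sum_(a <- s) u a];
  gm_indep : forall (s : seq 'rV[int]_n) (u : 'rV[int]_n -> gm_sort),
    uniq s -> (forall a, gm_comp a (u a)) -> \sum_(a <- s) u a = 0 ->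
    forall a, a \in s -> u a = 0 }.

Definition homogeneous (M : graded_module) (u : M) : Prop :=
  exists a, gm_comp a u.

(* v lies in K[Z]. *)
Definition subpoly (Z : {set 'I_n}) (v : S) : Prop :=
  forall m, m \in msupp v -> forall i, m i != 0%N -> i \in Z.

Definition cyclic_space (M : lmodType S) (u : M) (Z : {set 'I_n}) (w : M) :
    Prop :=
  exists2 v : S, subpoly Z v & w = v *: u.

(* u K[Z] is free over K[Z] with basis u; in particular u != 0. *)
Definition stanley_space (M : graded_module) (u : M) (Z : {set 'I_n}) : Prop :=
  homogeneous u /\ (forall v : S, subpoly Z v -> v *: u = 0 -> v = 0).

Definition stanley_decomposition (M : graded_module) (r : nat)
    (u : 'I_r -> M) (Z : 'I_r -> {set 'I_n}) : Prop :=
  [/\ forall j, stanley_space (u j) (Z j),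
      forall x : M, exists2 w : 'I_r -> M,
        (forall j, cyclic_space (u j) (Z j) (w j)) & x = \sum_j w j
    & forall w : 'I_r -> M, (forall j, cyclic_space (u j) (Z j) (w j)) ->
        \sum_j w j = 0 -> forall j, w j = 0].

(* [None] stands for infinity. Since #|Z j| <= n, the default value n does not
   affect the minimum of a nonempty family. *)
Definition sdepth_decomposition (r : nat) (Z : 'I_r -> {set 'I_n}) : option nat :=
  if r == 0%N then None else Some (\big[minn/n]_(j < r) #|Z j|).

Definition has_decomposition_of_sdepth (M : graded_module) (d : option nat) :=
  exists (r : nat) (u : 'I_r -> M) (Z : 'I_r -> {set 'I_n}),
    stanley_decomposition u Z /\ sdepth_decomposition Z = d.

(* The maximum is attained when M is finitely generated, as M then has a
   Stanley decomposition. *)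
Definition sdepth (M : graded_module) : option nat :=
  if `[< has_decomposition_of_sdepth M None >] then None
  else Some (\max_(d < n.+1 |
    `[< has_decomposition_of_sdepth M (Some (val d)) >]) d).

End GradedModules.

Section Instances.
Variables (K : fieldType) (n : nat).
Local Notation S := {mpoly K[n]}.
Implicit Types (I : monomial_ideal K n) (f g : S) (m : 'X_{1..n}).
Implicit Types (a : 'rV[int]_n).

Definition poly_comp a f : Prop := forall m, m \in msupp f -> mnm_deg m = a.

Lemma mnm_degD m1 m2 : mnm_deg (m1 + m2)%MM = mnm_deg m1 + mnm_deg m2.
Proof. by apply/rowP => i; rewrite !mxE mnmDE PoszD. Qed.

Lemma poly_comp0 a : poly_comp a 0.
Proof. by move=> m; rewrite msupp0. Qed.

Lemma poly_compD a f g : poly_comp a f -> poly_comp a g -> poly_comp a (f + g).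
Proof. by move=> hf hg m /msuppD_le; rewrite mem_cat => /orP[/hf|/hg]. Qed.

Lemma poly_compM a b f g :
  poly_comp a f -> poly_comp b g -> poly_comp (a + b) (f * g).
Proof.
move=> hf hg m /msuppM_le/allpairsP[[c d] /= [/hf <- /hg <- ->]].
exact: mnm_degD.
Qed.

Lemma poly_compC (c : K) : poly_comp 0 (c%:MP : S).
Proof.
move=> m; rewrite msuppC; case: ifP => // _; rewrite inE => /eqP ->.
by apply/rowP => i; rewrite !mxE mnm0E.
Qed.

Lemma poly_compX m : poly_comp (mnm_deg m) ('X_[m] : S).
Proof. by move=> m'; rewrite msuppX inE => /eqP ->. Qed.

Lemma poly_compZ a (c : K) f : poly_comp a f -> poly_comp a (c%:MP * f).
Proof.
move=> hf; rewrite -[a]add0r; apply: poly_compM => //; exact: poly_compC.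
Qed.

Definition poly_part a f : S :=
  \sum_(m <- msupp f | mnm_deg m == a) f@_m *: 'X_[m].

Lemma mcoeff_part a f m :
  (poly_part a f)@_m = if mnm_deg m == a then f@_m else 0.
Proof.
rewrite /poly_part raddf_sum /=.
have [mf|mf] := boolP (m \in msupp f); last first.
  rewrite (memN_msupp_eq0 mf) if_same big_seq_cond big1 // => k /andP[kf _].
  rewrite mcoeffZ mcoeffX; case: eqP => [e|_]; last by rewrite mulr0.
  by rewrite -e kf in mf.
have h k : k != m -> (f@_k *: 'X_[k])@_m = 0 :> K.
  by move=> km; rewrite mcoeffZ mcoeffX (negbTE km) mulr0.
case: ifP => [e|e]; last first.
  rewrite big1 // => k ke; apply: h; apply/eqP => km.
  by rewrite km e in ke.
rewrite -big_filter (bigD1_seq m) ?mem_filter ?e ?filter_uniq ?msupp_uniq //=.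
by rewrite mcoeffZ mcoeffX eqxx mulr1 big1 ?addr0.
Qed.

Lemma poly_part_comp a f : poly_comp a (poly_part a f).
Proof. by move=> m; rewrite mcoeff_msupp mcoeff_part; case: (mnm_deg m =P a) => //; rewrite eqxx. Qed.

Lemma mcoeff_sum_comp (s : seq 'rV[int]_n) (F : 'rV[int]_n -> S) a m :
  uniq s -> (forall b, poly_comp b (F b)) -> a \in s -> m \in msupp (F a) ->
  (\sum_(b <- s) F b)@_m = (F a)@_m.
Proof.
move=> us hF sa ma; rewrite raddf_sum /= (bigD1_seq a) //= big1 ?addr0 // => b ba.
apply: memN_msupp_eq0; apply/negP => mb.
by rewrite -(hF _ _ mb) -(hF _ _ ma) eqxx in ba.
Qed.

Lemma poly_part_sum f :
  \sum_(a <- undup [seq mnm_deg m | m <- msupp f]) poly_part a f = f.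
Proof.
apply/mpolyP => m; have [mf|mf] := boolP (m \in msupp f).
  rewrite (@mcoeff_sum_comp _ (poly_part ^~ f) (mnm_deg m)) ?undup_uniq //.
  - by rewrite mcoeff_part eqxx.
  - by move=> b; apply: poly_part_comp.
  - by rewrite mem_undup map_f.
  - by rewrite mcoeff_msupp mcoeff_part eqxx -mcoeff_msupp.
rewrite raddf_sum /= big1 ?(memN_msupp_eq0 mf) // => a _.
by rewrite mcoeff_part (memN_msupp_eq0 mf) if_same.
Qed.

Lemma poly_part_mem I a f :
  f \in (I : {pred S}) -> poly_part a f \in (I : {pred S}).
Proof.
move=> /midealP hf; apply/midealP => m mp; apply: hf.
by move: mp; rewrite !mcoeff_msupp mcoeff_part; case: ifP => //; rewrite eqxx.
Qed.

Lemma comp_mem I (s : seq 'rV[int]_n) (F : 'rV[int]_n -> S) :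
  uniq s -> (forall b, poly_comp b (F b)) ->
  \sum_(b <- s) F b \in (I : {pred S}) ->
  forall a, a \in s -> F a \in (I : {pred S}).
Proof.
move=> us hF /midealP hI a sa; apply/midealP => m ma; apply: hI.
by rewrite mcoeff_msupp (mcoeff_sum_comp us hF sa ma) -mcoeff_msupp.
Qed.

Section SubModule.
Variable I : monomial_ideal K n.

Definition sub_mod : Type := {f : S^o | f \in mideal_pred I}.
HB.instance Definition _ := SubChoice.on sub_mod.
HB.instance Definition _ := [SubChoice_isSubLmodule of sub_mod by <:].

Definition sub_comp a (u : sub_mod) : Prop := poly_comp a (val u : S).

Lemma sub_comp0 a : sub_comp a 0.
Proof. exact: poly_comp0. Qed.

Lemma sub_compD a u v : sub_comp a u -> sub_comp a v -> sub_comp a (u + v).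
Proof. exact: poly_compD. Qed.

Lemma sub_compZ a (c : K) u : sub_comp a u -> sub_comp a (c%:MP *: u).
Proof. exact: poly_compZ. Qed.

Lemma sub_compX a m u :
  sub_comp a u -> sub_comp (mnm_deg m + a) (('X_[m] : S) *: u).
Proof. by move=> hu; apply: poly_compM => //; apply: poly_compX. Qed.

Lemma sub_span (x : sub_mod) :
  exists (s : seq 'rV[int]_n) (u : 'rV[int]_n -> sub_mod),
    [/\ uniq s, forall a, sub_comp a (u a) & x = \sum_(a <- s) u a].
Proof.
exists (undup [seq mnm_deg m | m <- msupp (val x : S)]).
exists (fun a => exist _ (poly_part a (val x : S)) (poly_part_mem a (valP x))).
split; first exact: undup_uniq.
  by move=> a; apply: poly_part_comp.
by apply: val_inj; rewrite raddf_sum /= poly_part_sum.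
Qed.

Lemma sub_indep (s : seq 'rV[int]_n) (u : 'rV[int]_n -> sub_mod) :
  uniq s -> (forall a, sub_comp a (u a)) -> \sum_(a <- s) u a = 0 ->
  forall a, a \in s -> u a = 0.
Proof.
move=> us hu /(congr1 val); rewrite raddf_sum /= => e a sa.
apply: val_inj => /=; apply/eqP; rewrite -msupp_eq0; apply/eqP.
case E: (msupp _) => [//|m r]; have ma : m \in msupp (val (u a) : S).
  by rewrite E mem_head.
have := @mcoeff_sum_comp _ (fun b => val (u b) : S) a m us hu sa ma.
rewrite e mcoeff0 => /esym/eqP h.
by rewrite mcoeff_msupp h in ma.
Qed.

Definition ideal_module : graded_module K n :=
  @GradedModule K n sub_mod sub_comp sub_comp0 sub_compD sub_compZ sub_compX
    sub_span sub_indep.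

End SubModule.

Section QuotientModule.
Variable I : monomial_ideal K n.

Definition mideal_zmod : zmodClosed S^o := mideal_pred I.
Definition quot_mod : Type := Quotient.quot mideal_zmod.
HB.instance Definition _ := GRing.Zmodule.on quot_mod.
Local Notation pi := (\pi_(Quotient.quot mideal_zmod)).

Lemma quot_pi_eq f g : pi f = pi g <-> f - g \in (I : {pred S}).
Proof.
have := @Quotient.idealrBE _ mideal_zmod f g; rewrite /in_mem /= => ->.
by split=> [->|/eqP].
Qed.

Definition quot_scale (c : S) (x : quot_mod) : quot_mod :=
  pi (c *: (repr x : S^o)).

Lemma quot_scale_pi c (x : S^o) : quot_scale c (pi x) = pi (c *: x).
Proof.
apply/quot_pi_eq; rewrite -[_ - _](@scalerBr _ S^o); apply: midealM.
by apply/quot_pi_eq; rewrite reprK.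
Qed.

Lemma quot_scaleA c d x : quot_scale c (quot_scale d x) = quot_scale (c * d) x.
Proof. by elim/quotW: x => x; rewrite (quot_scale_pi d) !quot_scale_pi scalerA. Qed.

Lemma quot_scale1 : left_id 1 quot_scale.
Proof. by elim/quotW => x; rewrite quot_scale_pi scale1r. Qed.

Lemma quot_scaleDr : right_distributive quot_scale +%R.
Proof.
move=> c; elim/quotW => x; elim/quotW => y.
rewrite !quot_scale_pi.
by rewrite -[pi x + pi y]raddfD quot_scale_pi scalerDr raddfD.
Qed.

Lemma quot_scaleDl x : {morph quot_scale^~ x : c d / c + d}.
Proof.
by elim/quotW: x => x c d; rewrite !quot_scale_pi scalerDl raddfD.
Qed.

HB.instance Definition _ := GRing.Zmodule_isLmodule.Build S quot_mod
  quot_scaleA quot_scale1 quot_scaleDr quot_scaleDl.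

Definition quot_comp a (x : quot_mod) : Prop :=
  exists2 f : S, poly_comp a f & x = pi f.

Lemma quot_comp0 a : quot_comp a 0.
Proof. by exists 0; [exact: poly_comp0 | rewrite raddf0]. Qed.

Lemma quot_compD a x y : quot_comp a x -> quot_comp a y -> quot_comp a (x + y).
Proof.
move=> [f hf ->] [g hg ->]; exists (f + g); first exact: poly_compD.
by rewrite raddfD.
Qed.

Lemma quot_compZ a (c : K) x : quot_comp a x -> quot_comp a (c%:MP *: x).
Proof.
move=> [f hf ->]; exists (c%:MP * f); first exact: poly_compZ.
exact: quot_scale_pi.
Qed.

Lemma quot_compX a m x :
  quot_comp a x -> quot_comp (mnm_deg m + a) (('X_[m] : S) *: x).
Proof.
move=> [f hf ->]; exists ('X_[m] * f); last exact: quot_scale_pi.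
by apply: poly_compM => //; apply: poly_compX.
Qed.

Lemma quot_span (x : quot_mod) :
  exists (s : seq 'rV[int]_n) (u : 'rV[int]_n -> quot_mod),
    [/\ uniq s, forall a, quot_comp a (u a) & x = \sum_(a <- s) u a].
Proof.
elim/quotW: x => f; exists (undup [seq mnm_deg m | m <- msupp (f : S)]).
exists (fun a => pi (poly_part a (f : S))); split; first exact: undup_uniq.
  by move=> a; exists (poly_part a f) => //; apply: poly_part_comp.
by rewrite -[in LHS](poly_part_sum f) raddf_sum.
Qed.

Lemma quot_indep (s : seq 'rV[int]_n) (u : 'rV[int]_n -> quot_mod) :
  uniq s -> (forall a, quot_comp a (u a)) -> \sum_(a <- s) u a = 0 ->
  forall a, a \in s -> u a = 0.
Proof.
move=> us hu.
have hu' a : exists f : S, poly_comp a f /\ u a = pi f.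
  by case: (hu a) => f; exists f.
have [F hF] := choice hu'.
have pi_eq0 (f : S) : pi f = 0 <-> f \in (I : {pred S}).
  by rewrite -[X in X \in _]subr0 -quot_pi_eq raddf0.
rewrite (eq_bigr (fun a => pi (F a))) => [|a _]; last by case: (hF a).
rewrite -raddf_sum => /pi_eq0 e a sa; case: (hF a) => _ ->; apply/pi_eq0.
by apply: (comp_mem us _ e sa) => b; case: (hF b).
Qed.

Definition quotient_module : graded_module K n :=
  @GradedModule K n quot_mod quot_comp quot_comp0 quot_compD quot_compZ
    quot_compX quot_span quot_indep.

End QuotientModule.
End Instances.

(* Main.v *)
(* A Stanley decomposition of I^k or S/I^k amounts to a partition of its set of
   monomials into boxes. If I is normal, X^m lies in I^k iff X^(s m) lies in
   I^(s k), so pulling a partition for s k back along m |-> s m gives one for k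
   whose boxes have dimensions among the original ones. Hence
   sdepth I^(s k) <= sdepth I^k, and any k minimizing sdepth I^k over k >= 1
   works; likewise for S/I^k. *)
Require Import Defs.
From mathcomp Require Import all_boot all_order all_algebra.
From mathcomp Require Import generic_quotient boolp mpoly zify.

Set Implicit Arguments.
Unset Strict Implicit.
Unset Printing Implicit Defensive.

Import GRing.Theory.
Local Open Scope ring_scope.
Local Open Scope quotient_scope.

(** * Powers of ideals and normality *)

Section IdealPowers.
Variable R : comNzRingType.
Implicit Types (I : {pred R}) (f g : R) (k s : nat).

Lemma ideal_powM I a b f g :
  f \in ideal_pow I a -> g \in ideal_pow I b -> f * g \in ideal_pow I (a + b).
Proof.
move=> /asboolP[s hs ->] /asboolP[t ht ->]; apply/asboolP.
rewrite mulr_suml; apply: ideal_gen_sum => p /hs[u hu ->].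
rewrite mulr_sumr; apply: ideal_gen_sum => q /ht[v hv ->].
rewrite mulrACA; apply/ideal_genM/ideal_gen_mem.
exists [tuple of u ++ v]; last by rewrite big_cat.
by move=> h; rewrite mem_cat => /orP[/hu|/hv].
Qed.

Lemma ideal_powX I k s f :
  f \in ideal_pow I k -> f ^+ s \in ideal_pow I (s * k).
Proof.
move=> hf; elim: s => [|s IH]; last by rewrite exprS mulSn; apply: ideal_powM.
by apply/asboolP/ideal_gen_mem; exists [tuple]; rewrite ?big_nil.
Qed.

Lemma ideal_powN I k f : f \in ideal_pow I k -> - f \in ideal_pow I k.
Proof. by move=> /asboolP hf; apply/asboolP; rewrite -mulN1r; apply: ideal_genM. Qed.

(** Cut the [s * k] factors into [s] consecutive blocks of [k]; each block product lies in
    [ideal_pow I k]. *)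
Lemma prods_of_pow I s k f :
  prods_of I (s * k) f -> prods_of (ideal_pow I k) s f.
Proof.
case=> -[t /= /eqP ht] hI ->; elim: s t ht hI => [|s IH] t ht hI.
  by rewrite (size0nil ht) big_nil; exists [tuple]; rewrite ?big_nil.
have [|g|u hu eu] := IH (drop k t); first by rewrite size_drop ht mulSn addKn.
  by move/mem_drop; apply: hI.
have st : size (take k t) == k.
  by apply/eqP; rewrite size_takel // ht mulSn leq_addr.
exists [tuple of \prod_(g <- take k t) g :: u].
  move=> g; rewrite inE => /orP[/eqP ->|/hu //]; apply/asboolP/ideal_gen_mem.
  by exists (Tuple st) => // h /mem_take; apply: hI.
by rewrite big_cons -eu -big_cat cat_take_drop.
Qed.

Lemma ideal_pow_pow I s k f :
  f \in ideal_pow I (s * k) -> f \in ideal_pow (ideal_pow I k) s.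
Proof.
move=> /asboolP[t ht ->]; apply/asboolP; apply: ideal_gen_sum => p /ht hp.
exact/ideal_genM/ideal_gen_mem/prods_of_pow.
Qed.

(* If f^s is in I^(s k), then T^s - f^s = 0 is an integral equation of f over I^k. *)
Lemma normal_ideal_powX I k s f : normal_ideal I -> (1 <= k)%N -> (1 <= s)%N ->
  (f ^+ s \in ideal_pow I (s * k)) = (f \in ideal_pow I k).
Proof.
move=> hI k1 s1; apply/idP/idP => [hf|]; last exact: ideal_powX.
rewrite (hI k k1); apply/asboolP.
exists s, (fun i => if i == s then - f ^+ s else 0); split=> //.
  move=> i _; case: eqP => [->|_]; last by apply/asboolP/ideal_gen0.
  exact/ideal_powN/ideal_pow_pow.
rewrite big_nat_recr //= eqxx subnn expr0 mulr1 big_nat_cond big1 ?add0r ?subrr //.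
by move=> i /andP[/andP[_ lis] _]; rewrite ltn_eqF // mul0r.
Qed.

End IdealPowers.

(** * Boxes of exponents and their pullback under scaling *)

Section Boxes.
Variable n : nat.
Implicit Types (a m : 'X_{1..n}) (Z : {set 'I_n}) (P : pred 'X_{1..n}).

(* The exponents of the monomials spanning the Stanley space X^a K[Z]. *)
Definition box a Z : pred 'X_{1..n} := fun m =>
  [forall i, if i \in Z then (a i <= m i)%N else a i == m i].

Definition box_partition P r (a : 'I_r -> 'X_{1..n}) (Z : 'I_r -> {set 'I_n}) :=
  [/\ forall j m, box (a j) (Z j) m -> P m,
      forall m, P m -> exists j, box (a j) (Z j) m
    & forall i j m, box (a i) (Z i) m -> box (a j) (Z j) m -> i = j].

Lemma box_refl a Z : box a Z a.
Proof. by apply/forallP => i; rewrite leqnn eqxx if_same. Qed.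

Lemma box_lepm a Z m : box a Z m -> (a <= m)%MM.
Proof.
move=> /forallP h; apply/mnm_lepP => i.
by have := h i; case: ifP => // _ /eqP ->.
Qed.

Lemma box_addl a Z (b : 'X_{1..n}) : (forall i, b i != 0%N -> i \in Z) -> box a Z (b + a)%MM.
Proof.
move=> hb; apply/forallP => i; rewrite mnmDE leq_addl.
by case: ifPn => // /(contraNN (hb i))/negPn/eqP ->.
Qed.

Lemma box_sub a Z m i : box a Z m -> (m - a)%MM i != 0%N -> i \in Z.
Proof.
move=> /forallP/(_ i); rewrite mnmBE; case: ifP => // _ /eqP ->.
by rewrite subnn.
Qed.

(* The preimage of a box under m |-> s m is empty or a box with the same free
   directions, its corner being the coordinatewise quotient by s, rounded up. *)
Lemma box_scale_preim a Z s m0 : (0 < s)%N -> box a Z (m0 *+ s)%MM ->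
  box [multinom ((a i + s.-1) %/ s)%N | i < n] Z =1
  fun m => box a Z (m *+ s)%MM.
Proof.
move=> s0 /forallP h0 m; apply: eq_forallb => i.
have := h0 i; rewrite mnmE !mulmnE; case: ifP => _; last first.
  (* In a fixed direction the witness [m0] makes [a i] divisible by [s], so the rounded quotient is
     exactly [m0 i]. *)
  move=> /eqP ->; rewrite divnMDl // divn_small ?addn0 ?prednK //.
  by rewrite eqn_pmul2r.
by move=> _; rewrite -ltnS ltn_divLR // mulSn; apply/idP/idP; lia.
Qed.

(** The nonempty preimages of the boxes are disjoint and cover the preimage of [P]. The map [f]
    records the source of each new box, hence its free directions. *)
Lemma box_partition_preim P P' s r (a : 'I_r -> 'X_{1..n})
    (Z : 'I_r -> {set 'I_n}) : (0 < s)%N ->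
  (forall m, P' m = P (m *+ s)%MM) -> box_partition P a Z ->
  exists r' (f : 'I_r' -> 'I_r) (a' : 'I_r' -> 'X_{1..n}),
    box_partition P' a' (Z \o f).
Proof.
move=> s0 hP [hsub hcov hdis].
pose A := [set j | `[< exists m, box (a j) (Z j) (m *+ s)%MM >]].
have hA k m : let j := enum_val (k : 'I_#|A|) in
    box [multinom ((a j i + s.-1) %/ s)%N | i < n] (Z j) m
    = box (a j) (Z j) (m *+ s)%MM.
  have := enum_valP k; rewrite inE => /asboolP[m0 h0] /=.
  exact: (box_scale_preim s0 h0).
exists #|A|, enum_val.
exists (fun k => [multinom ((a (enum_val k) i + s.-1) %/ s)%N | i < n]).
split=> [k m|m|k l m]; rewrite ?hP /= ?hA; first exact: hsub.
- move=> /hcov[j hj]; have jA : j \in A by rewrite inE; apply/asboolP; exists m.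
  by exists (enum_rank_in jA j); rewrite hA enum_rankK_in.
- by move=> hk hl; apply: enum_val_inj; apply: hdis hk hl.
Qed.

End Boxes.

(** * Stanley decompositions and box partitions *)

Section MonomialBasis.
Variables (K : fieldType) (n : nat).
Local Notation S := {mpoly K[n]}.
Implicit Types (P : pred 'X_{1..n}) (a m : 'X_{1..n}) (v : S).

(* Models I with P the monomials in I, and S/I with P the monomials outside I:
   a Z^n-graded module with a K-basis indexed by P on which monomials act by
   translation of exponents. Outside P the values of both maps are junk. *)
Record monomial_basis (M : graded_module K n) P := MonomialBasis {
  mb_vec : 'X_{1..n} -> M;
  mb_coef : 'X_{1..n} -> M -> K;
  mb_coefD : forall m, P m -> {morph mb_coef m : x y / x + y};
  mb_coefZ : forall m a v, P m -> P a ->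
    mb_coef m (v *: mb_vec a) = (v * 'X_[a])@_m;
  mb_coef_inj : forall x, (forall m, P m -> mb_coef m x = 0) -> x = 0;
  mb_supp : forall x, exists2 s : seq 'X_{1..n},
    uniq s & forall m, P m -> mb_coef m x != 0 -> m \in s;
  mb_homog : forall a, P a -> homogeneous (mb_vec a);
  mb_homogP : forall u, homogeneous u -> u != 0 ->
    exists (c : K) a, [/\ P a, c != 0 & u = c%:MP *: mb_vec a] }.

Section Theory.
Variables (M : graded_module K n) (P : pred 'X_{1..n}).
Variable B : monomial_basis M P.
Local Notation e := (mb_vec B).
Local Notation coef := (mb_coef B).

Lemma mb_coef0 m : P m -> coef m 0 = 0.
Proof.
by move=> Pm; apply: (addrI (coef m 0)); rewrite -mb_coefD // !addr0.
Qed.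

Lemma mb_coef_sum m (T : Type) (s : seq T) (F : T -> M) : P m ->
  coef m (\sum_(x <- s) F x) = \sum_(x <- s) coef m (F x).
Proof. by move=> Pm; apply: big_morph; [apply: mb_coefD|apply: mb_coef0]. Qed.

Lemma mb_coefN m x : P m -> coef m (- x) = - coef m x.
Proof.
by move=> Pm; apply: (addrI (coef m x)); rewrite -mb_coefD // !subrr mb_coef0.
Qed.

Lemma mb_coef_eq x y : (forall m, P m -> coef m x = coef m y) -> x = y.
Proof.
move=> h; apply/eqP; rewrite -subr_eq0; apply/eqP/(@mb_coef_inj _ _ B) => m Pm.
by rewrite mb_coefD // mb_coefN // h // subrr.
Qed.

Lemma mb_coef_vec m a : P m -> P a -> coef m (e a) = (a == m)%:R.
Proof.
by move=> Pm Pa; rewrite -[e a]scale1r mb_coefZ // mul1r mcoeffX.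
Qed.

Lemma mb_shift b a : P (b + a)%MM -> P a -> ('X_[b] : S) *: e a = e (b + a)%MM.
Proof.
move=> Pba Pa; apply: mb_coef_eq => m Pm.
by rewrite mb_coefZ // mb_coef_vec // -mpolyXD mcoeffX.
Qed.

Lemma mulX_box a Z v m : subpoly Z v -> (v * 'X_[a])@_m != 0 -> box a Z m.
Proof.
move=> hv; rewrite -mcoeff_msupp => /msuppM_le/allpairsP[[b c] /= [hb]].
by rewrite msuppX inE => /eqP -> ->; apply/box_addl/hv.
Qed.

Lemma cyclic_coef_box a Z w m : P m -> P a -> cyclic_space (e a) Z w ->
  coef m w != 0 -> box a Z m.
Proof. by move=> Pm Pa [v hv ->]; rewrite mb_coefZ //; apply: mulX_box. Qed.

Lemma cyclic_vec a Z m : P m -> P a -> box a Z m -> cyclic_space (e a) Z (e m).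
Proof.
move=> Pm Pa hm; have am := box_lepm hm; exists 'X_[m - a].
  by move=> m'; rewrite msuppX inE => /eqP -> i; apply: box_sub hm.
by rewrite mb_shift // submK.
Qed.

(** The constant is absorbed into the coefficient polynomial, so generators can be normalised to
    basis vectors. *)
Lemma cyclicZ (u : M) Z (c : K) : c != 0 ->
  cyclic_space (c%:MP *: u) Z =1 cyclic_space u Z.
Proof.
have subC (d : K) v : subpoly Z v -> subpoly Z (v * d%:MP).
  by move=> hv m; rewrite mulrC mul_mpolyC => /msuppZ_le; apply: hv.
move=> c0 w; apply/propext; split=> [[v hv ->]|[v hv ->]].
  by exists (v * c%:MP); rewrite ?scalerA //; apply: subC.
exists (v * c^-1%:MP); first exact: subC.
by rewrite scalerA -mulrA -mpolyCM mulVf // mulr1.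
Qed.

Lemma cyclic_sum (u : M) Z (T : Type) (s : seq T) (Q : pred T) (F : T -> M)
    (c : T -> K) : (forall x, Q x -> cyclic_space u Z (F x)) ->
  cyclic_space u Z (\sum_(x <- s | Q x) (c x)%:MP *: F x).
Proof.
move=> hF; apply: (big_ind (cyclic_space u Z)).
- by exists 0; rewrite ?scale0r // => m; rewrite msupp0.
- move=> _ _ [v hv ->] [w hw ->]; exists (v + w); rewrite ?scalerDl // => m.
  by move=> /msuppD_le; rewrite mem_cat => /orP[/hv|/hw].
- move=> x /hF[v hv ->]; exists ((c x)%:MP * v); rewrite ?scalerA // => m.
  by rewrite mul_mpolyC => /msuppZ_le; apply: hv.
Qed.

(** Generators are scalar multiples of basis vectors. Freeness keeps each box inside [P], spanning
    makes the boxes cover [P], and directness of the sum makes them disjoint. *)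
Lemma stanley_decomposition_box r (u : 'I_r -> M) (Z : 'I_r -> {set 'I_n}) :
  stanley_decomposition u Z -> exists a : 'I_r -> 'X_{1..n}, box_partition P a Z.
Proof.
case=> hst hspan hind.
have hu j : exists ca : K * 'X_{1..n},
    [/\ P ca.2, ca.1 != 0 & u j = ca.1%:MP *: e ca.2].
  have [hj fj] := hst j; have [|c [a h]] := mb_homogP B hj; last by exists (c, a).
  (* Freeness applied to the polynomial 1 rules out [u j = 0]. *)
  apply/eqP => u0; have /eqP : (1 : S) = 0.
    apply: fj; last by rewrite u0 scaler0.
    by move=> m; rewrite msupp1 inE => /eqP -> i; rewrite mnm0E.
  by rewrite oner_eq0.
have [ca hca] := choice hu.
pose a j := (ca j).2; pose c j := (ca j).1.
have Pa j : P (a j) by case: (hca j).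
have c0 j : c j != 0 by case: (hca j).
have uE j : u j = (c j)%:MP *: e (a j) by case: (hca j).
have cyc j w : cyclic_space (u j) (Z j) w = cyclic_space (e (a j)) (Z j) w.
  by rewrite uE cyclicZ.
have hsub j m : box (a j) (Z j) m -> P m.
  move=> hm; apply: contraT => Pm.
  (* If [m] were outside [P], the nonzero monomial ['X_[m - a j]] would kill [u j]. *)
  have [_ fj] := hst j; have /mpolyP/(_ (m - a j)%MM)/eqP : 'X_[m - a j] = 0 :> S.
    apply: fj; last first.
      rewrite uE; apply: mb_coef_eq => m' Pm'.
      rewrite scalerA mb_coefZ // mb_coef0 // [_ * (c j)%:MP]mulrC.
      rewrite -mulrA mcoeffCM -mpolyXD (submK (box_lepm hm)) mcoeffX.
      case: eqP => [mm'|_]; last by rewrite mulr0.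
      by rewrite mm' Pm' in Pm.
    by move=> m'; rewrite msuppX inE => /eqP -> i; apply: box_sub hm.
  by rewrite mcoeffX mcoeff0 eqxx oner_eq0.
exists a; split=> // [m Pm|i j m hi hj].
  (* The coefficient 1 of [e m] at [m] must come from some summand, whose box then contains [m]. *)
  have [w hw eqw] := hspan (e m).
  have := mb_coef_vec Pm Pm; rewrite eqw mb_coef_sum // eqxx => w1.
  have [j /= hj] : exists j, coef m (w j) != 0.
    apply/existsP; apply: contraT; rewrite negb_exists => /forallP h.
    move/eqP: w1; rewrite big1 ?(eq_sym 0) ?oner_eq0 // => j _.
    by have := h j; rewrite negbK => /eqP.
  by exists j; apply: cyclic_coef_box hj; rewrite -?cyc.
apply/eqP; apply: contraT => ij; have Pm := hsub _ _ hi.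
(* A point [m] common to two boxes would give the nontrivial relation [e m - e m = 0]. *)
pose w k := if k == i then e m else if k == j then - e m else 0.
have w0 : \sum_k w k = 0.
  rewrite (bigD1 i) //= (bigD1 j) /=; last by rewrite eq_sym.
  rewrite big1 => [|k /andP[ki kj]]; last by rewrite /w (negbTE ki) (negbTE kj).
  by rewrite /w !eqxx eq_sym (negbTE ij) addr0 subrr.
have hw k : cyclic_space (u k) (Z k) (w k).
  rewrite cyc /w; case: eqP => [->|_]; first exact: cyclic_vec.
  have [v hv ev] := cyclic_vec Pm (Pa j) hj.
  case: eqP => [->|_].
    exists (- v); last by rewrite scaleNr -ev.
    by move=> m'; rewrite (perm_mem (msuppN _)); apply: hv.
  by exists 0; rewrite ?scale0r // => m'; rewrite msupp0.
have := congr1 (coef m) (hind w hw w0 i).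
by rewrite /w eqxx mb_coef_vec // mb_coef0 // eqxx => /eqP; rewrite oner_eq0.
Qed.

(** Each exponent of [P] lies in exactly one box, so expanding in the basis and grouping terms by
    box gives existence and uniqueness. *)
Lemma box_stanley_decomposition r (a : 'I_r -> 'X_{1..n})
    (Z : 'I_r -> {set 'I_n}) :
  box_partition P a Z -> stanley_decomposition (fun j => e (a j)) Z.
Proof.
case=> hsub hcov hdis.
have Pa j : P (a j) by apply/hsub/box_refl.
split=> [j|x|w hw w0 j].
- split=> [|v hv v0]; first exact: mb_homog.
  (* The coefficient of [v] at [b] reappears in [v *: e (a j)] at [b + a j], which lies in the box
     and hence in [P]. *)
  apply/mpolyP => b; rewrite mcoeff0; apply/eqP; apply: contraT.
  rewrite -mcoeff_msupp => hb; have hba := box_addl (a j) (hv b hb).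
  have := congr1 (coef (b + a j)%MM) v0.
  have Pba := hsub _ _ hba.
  by rewrite mb_coefZ // mb_coef0 // addmC mcoeffMX => vb; rewrite mcoeff_msupp vb eqxx in hb.
- have [s us hs] := mb_supp B x.
  (* The [j]-th component collects the terms of [x] whose exponents lie in the [j]-th box. *)
  pose Q j m := P m && box (a j) (Z j) m.
  exists (fun j => \sum_(m <- s | Q j m) (coef m x)%:MP *: e m) => [j|].
    by apply: cyclic_sum => m /andP[Pm hm]; apply: cyclic_vec.
  apply: mb_coef_eq => m Pm; rewrite mb_coef_sum //.
  have [j0 hj0] := hcov m Pm.
  have E j : coef m (\sum_(m <- s | Q j m) (coef m x)%:MP *: e m) =
      if j == j0 then coef m x else 0.
    rewrite -big_filter mb_coef_sum // big_filter.
    rewrite (eq_bigr (fun m' => coef m' x * (m' == m)%:R)); last first.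
      by move=> m' /andP[Pm' _]; rewrite mb_coefZ // mcoeffCM mcoeffX.
    have Qj : Q j m = (j == j0).
      rewrite /Q Pm /=; apply/idP/eqP => [hj|-> //]; exact: hdis hj hj0.
    have [ms|ms] := boolP (m \in s).
      rewrite -Qj -big_filter; case: ifP => Qm.
        rewrite (bigD1_seq m) ?mem_filter ?Qm ?filter_uniq //= eqxx mulr1.
        by rewrite big1 ?addr0 // => m' /negbTE ->; rewrite mulr0.
      rewrite big_seq big1 // => m'; rewrite mem_filter => /andP[Qm' _].
      by case: eqP => [mm'|_]; [rewrite -mm' Qm' in Qm|rewrite mulr0].
    have -> : coef m x = 0.
      by apply/eqP; apply: contraNT ms => /(hs m Pm).
    rewrite if_same big_seq_cond big1 // => m' /andP[ms' _].
    by case: eqP => [mm'|_]; [rewrite -mm' ms' in ms|rewrite mulr0].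
  by under eq_bigr do rewrite E; rewrite -big_mkcond big_pred1_eq.
(* A nonzero coefficient of [w j] at [m] puts [m] in box [j] alone, so no other summand can cancel
   it. *)
apply: (@mb_coef_inj _ _ B) => m Pm; apply/eqP; apply: contraT => wm.
have hj := cyclic_coef_box Pm (Pa j) (hw j) wm.
have := mb_coef0 Pm; rewrite -w0 mb_coef_sum // (bigD1 j) //= big1 ?addr0.
  by move/eqP; rewrite (negbTE wm).
move=> i ij; apply/eqP; apply: contraNT ij => wi; apply/eqP.
exact: hdis (cyclic_coef_box Pm (Pa i) (hw i) wi) hj.
Qed.

End Theory.
End MonomialBasis.

(** * Comparison of Stanley depths *)

Section Sdepth.
Variables (K : fieldType) (n : nat).

(* Since dimensions are at most n, the rank n + 1 stands for infinity. *)
Definition sdepth_rank (M : graded_module K n) : nat := odflt n.+1 (sdepth M).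

Lemma sdepth_leq (M : graded_module K n) d : sdepth M = Some d -> (d <= n)%N.
Proof.
rewrite /sdepth; case: ifP => // _ [<-].
by apply/bigmax_leqP => i _; rewrite -ltnS.
Qed.

Lemma sdepth_rank_inj (M M' : graded_module K n) :
  sdepth_rank M = sdepth_rank M' -> sdepth M = sdepth M'.
Proof.
rewrite /sdepth_rank; case E: (sdepth M) => [d|]; case E': (sdepth M') => [d'|] //=.
- by move=> ->.
- by move=> e; have := sdepth_leq E; rewrite e ltnn.
- by move=> e; have := sdepth_leq E'; rewrite -e ltnn.
Qed.

(** The new family is drawn from the old one, so its minimum cannot be smaller, unless it is empty
    and the depth is infinite. The bound by [n] places [d'] in the range of the maximum defining
    [sdepth]. *)
Lemma sdepth_decomposition_sub r r' (f : 'I_r' -> 'I_r) (Z : 'I_r -> {set 'I_n})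
    d : sdepth_decomposition Z = Some d ->
  sdepth_decomposition (Z \o f) = None \/
  exists2 d', (d <= d' <= n)%N & sdepth_decomposition (Z \o f) = Some d'.
Proof.
rewrite /sdepth_decomposition; case: (r == 0)%N => // -[<-].
case: (r' == 0)%N; [by left|right]; eexists; last by [].
have bound q (Y : 'I_q -> {set 'I_n}) : (\big[minn/n]_(j < q) #|Y j| <= n)%N.
  by apply: (big_ind (fun d => d <= n)%N) => // [x y xn yn|j _];
     rewrite ?geq_min ?xn // -[X in (_ <= X)%N](card_ord n) max_card.
rewrite bound andbT.
apply: (big_ind (fun d => (\big[minn/n]_(j < r) #|Z j| <= d)%N)) => //.
  by move=> x y hx hy; rewrite leq_min hx.
move=> j _ /=; have := mem_index_enum (f j); elim: (index_enum _) => // i l IH.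
rewrite inE big_cons geq_min => /orP[/eqP <-|/IH ->]; by rewrite ?leqnn ?orbT.
Qed.

Variables (M M' : graded_module K n) (P P' : pred 'X_{1..n}).
Hypotheses (B : monomial_basis M P) (B' : monomial_basis M' P').
Variable s : nat.
Hypotheses (s_gt0 : (0 < s)%N) (P'E : forall m, P' m = P (m *+ s)%MM).

Lemma has_decomposition_preim d : has_decomposition_of_sdepth M d ->
  exists r r' (f : 'I_r' -> 'I_r) (Z : 'I_r -> {set 'I_n}),
    sdepth_decomposition Z = d /\
    has_decomposition_of_sdepth M' (sdepth_decomposition (Z \o f)).
Proof.
case=> r [u [Z [/(stanley_decomposition_box B)[a ha] <-]]].
have [r' [f [a' ha']]] := box_partition_preim s_gt0 P'E ha.
exists r, r', f, Z; split=> //; exists r', (fun j => mb_vec B' (a' j)), (Z \o f).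
by split=> //; apply: box_stanley_decomposition.
Qed.

(** Every decomposition of [M] pulls back to one of [M'] that is at least as deep, so the maximum
    cannot drop. *)
Lemma sdepth_rank_preim : (sdepth_rank M <= sdepth_rank M')%N.
Proof.
rewrite /sdepth_rank; case E': (sdepth M') => [d'|] /=; last first.
  by case E: (sdepth M) => [d|] //=; apply/leqW/(sdepth_leq E).
move: E'; rewrite /sdepth; case: ifP => // /asboolP none' [<-].
case: ifP => [/asboolP none|_ /=].
  (* Infinite depth means an empty family, and [f] maps into its index set, so the pulled-back
     family is empty too. *)
  have [r [r' [f [Z [Z0 hM']]]]] := has_decomposition_preim none.
  case: none'; move: Z0 hM'; rewrite /sdepth_decomposition.
  case: eqP => // r0 _; case: eqP => // /eqP; rewrite -lt0n => r'0 _.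
  by have := f (Ordinal r'0); rewrite r0 => -[].
apply/bigmax_leqP => d /asboolP hd.
have [r [r' [f [Z [/sdepth_decomposition_sub-/(_ r' f) hZ hM']]]]] :=
  has_decomposition_preim hd.
(* An empty pullback would give [M'] infinite depth, excluded by [none']. *)
case: hZ hM' => [-> //|[d2 /andP[dd2 d2n] ->] hd2].
apply: leq_trans dd2 _; have d2n' : (d2 < n.+1)%N by [].
by apply: (leq_bigmax_cond (Ordinal d2n')); apply/asboolP.
Qed.

End Sdepth.

(** * Monomial bases of I and S/I *)

Section Instances.
Variables (K : fieldType) (n : nat) (J : monomial_ideal K n).
Local Notation S := {mpoly K[n]}.

Definition ideal_mon : pred 'X_{1..n} := fun m => ('X_[m] : S) \in (J : {pred S}).

Lemma mcoeff_mideal (f : S) m : f \in (J : {pred S}) -> ~~ ideal_mon m -> f@_m = 0.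
Proof.
move=> /midealP hf hm; apply: memN_msupp_eq0; apply: contraNN hm; exact: hf.
Qed.

(** Distinct exponents have distinct multidegrees, so a homogeneous polynomial involves at most one
    monomial. *)
Lemma poly_comp_monomial a (f : S) : poly_comp a f -> f != 0 ->
  exists (c : K) m, [/\ c != 0, m \in msupp f & f = c%:MP * 'X_[m]].
Proof.
move=> hf f0; have [m mf] : exists m, m \in msupp f.
  move: f0; rewrite -msupp_eq0; case: (msupp f) => // m t _.
  by exists m; rewrite mem_head.
exists f@_m, m; split=> //; first by rewrite -mcoeff_msupp.
apply/mpolyP => m'; rewrite mcoeffCM mcoeffX; case: eqP => [->|ne].
  by rewrite mulr1.
rewrite mulr0; apply: memN_msupp_eq0; apply/negP => m'f; apply: ne.
have := hf _ mf; rewrite -(hf _ m'f) => /rowP e; apply/mnmP => i.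
by have := e i; rewrite !mxE => -[].
Qed.

Definition ideal_basis : monomial_basis (ideal_module J) ideal_mon.
Proof.
(* [insubd] returns the junk value 0 when the monomial is not in [J]. *)
pose e m : ideal_module J := insubd (0 : sub_mod J) ('X_[m] : S^o).
have eE m : ideal_mon m -> val (e m) = 'X_[m] by move=> hm; apply: insubdK.
pose coef m (x : ideal_module J) : K := (val (x : sub_mod J) : S)@_m.
apply: (@MonomialBasis _ _ _ _ e coef).
- by move=> m _ x y; rewrite /coef /= mcoeffD.
- by move=> m a v _ Pa; rewrite /coef /= eE.
- move=> x hx; apply: val_inj; apply/mpolyP => m; rewrite mcoeff0.
  have [/hx //|hm] := boolP (ideal_mon m); exact: mcoeff_mideal (valP x) hm.
- move=> x; exists (msupp (val x : S)) => [|m _]; first exact: msupp_uniq.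
  by rewrite mcoeff_msupp.
- move=> a Pa; exists (mnm_deg a); rewrite /= /sub_comp eE //; exact: poly_compX.
move=> u [a ha] u0; have [|c [m [c0 mu um]]] := poly_comp_monomial ha.
  by apply: contraNN u0 => /eqP u0; apply/eqP/val_inj.
have Pm : ideal_mon m by have /midealP := valP u; apply.
by exists c, m; split=> //; apply: val_inj; rewrite um /= eE.
Qed.

Definition quotient_basis :
  monomial_basis (quotient_module J) (fun m => ~~ ideal_mon m).
Proof.
pose p (f : S^o) : quotient_module J := \pi_(Quotient.quot (mideal_zmod J)) f.
pose coef m (x : quotient_module J) : K := (repr (x : quot_mod J) : S)@_m.
(* Representatives differ by elements of [J], whose coefficients vanish at monomials outside [J], so
   the choice of representative is harmless there. *)
have coefE m f : ~~ ideal_mon m -> coef m (p f) = (f : S)@_m.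
  move=> hm; apply/eqP; rewrite -subr_eq0 -mcoeffB; apply/eqP.
  by apply: mcoeff_mideal hm; apply/quot_pi_eq; rewrite reprK.
have pZ (v : S) (f : S^o) : v *: p f = p (v * f) by apply: quot_scale_pi.
have pK (x : quotient_module J) : exists f, x = p f.
  by exists (repr (x : quot_mod J)); rewrite /p reprK.
have p0 (f : S) : f \in (J : {pred S}) -> p f = 0.
  move=> hf; have -> : 0 = p 0 by rewrite /p raddf0.
  by apply/quot_pi_eq; rewrite subr0.
apply: (@MonomialBasis _ _ _ _ (fun m => p 'X_[m]) coef).
- move=> m hm x y; have [[f ->] [g ->]] := (pK x, pK y).
  have -> : p f + p g = p (f + g) by rewrite /p raddfD.
  by rewrite !coefE // mcoeffD.
- by move=> m a v hm _; rewrite pZ coefE.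
- move=> x; have [f ->] := pK x => hf; apply: p0; apply/midealP => m.
  rewrite mcoeff_msupp; apply: contraNT => hm; apply/eqP.
  by rewrite -coefE // hf.
- move=> x; exists (msupp (repr (x : quot_mod J) : S)) => [|m _].
    exact: msupp_uniq.
  by rewrite mcoeff_msupp.
- by move=> a _; exists (mnm_deg a), 'X_[a] => //; apply: poly_compX.
move=> u [a [f hf uf]] u0; have [|c [m [c0 mf fm]]] := poly_comp_monomial hf.
  by apply: contraNN u0 => /eqP f0; rewrite uf f0 -/(p 0) p0 // mideal0.
exists c, m; split=> //; last by rewrite pZ -fm.
apply: contraNN u0 => hm; rewrite uf -/(p f) fm p0 //; exact: midealM.
Qed.

End Instances.

(** * Minimizing exponents and the conclusion *)

(** Take [k] minimizing [d] over the positive integers: minimality gives [d k <= d (s * k)], and the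
    hypothesis gives the reverse. *)
Lemma ex_divisibility_min (d : nat -> nat) :
  (forall k s, (1 <= k)%N -> (1 <= s)%N -> (d (s * k) <= d k)%N) ->
  exists k, (1 <= k)%N /\ forall s, (1 <= s)%N -> d k = d (s * k)%N.
Proof.
move=> hd; have [k k1 kmin] : exists2 k, (1 <= k)%N &
    forall l, (1 <= l)%N -> (d k <= d l)%N.
  have exd : exists v, `[< exists2 k, (1 <= k)%N & d k = v >].
    by exists (d 1%N); apply/asboolP; exists 1%N.
  case: (ex_minnP exd) => v /asboolP[k k1 kv] vmin.
  by exists k => // l l1; rewrite kv; apply: vmin; apply/asboolP; exists l.
exists k; split=> // s s1; apply/eqP; rewrite eqn_leq hd // andbT.
by rewrite kmin // muln_gt0 s1.
Qed.

(** As ['X_[m *+ s]] is the [s]-th power of ['X_[m]], this is the normality criterion read on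
    exponents. *)
Lemma ideal_mon_pow (K : fieldType) (n : nat) (I : monomial_ideal K n) k s m :
  normal_ideal (I : {pred {mpoly K[n]}}) -> (1 <= k)%N -> (1 <= s)%N ->
  ideal_mon (mideal_pow I k) m = ideal_mon (mideal_pow I (s * k)) (m *+ s)%MM.
Proof.
by move=> hI k1 s1; rewrite /ideal_mon -mpolyXn; apply/esym/normal_ideal_powX.
Qed.

Theorem corollary2p7 (K : fieldType) (n : nat) (I : monomial_ideal K n)
    (hI : normal_ideal (I : {pred {mpoly K[n]}})) :
  (exists k : nat, (1 <= k)%N /\
     forall s : nat, (1 <= s)%N ->
       sdepth (ideal_module (mideal_pow I k)) =
       sdepth (ideal_module (mideal_pow I (s * k)))) /\
  (exists k : nat, (1 <= k)%N /\
     forall s : nat, (1 <= s)%N ->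
       sdepth (quotient_module (mideal_pow I k)) =
       sdepth (quotient_module (mideal_pow I (s * k)))).
Proof.
split.
- have [|k [k1 hk]] := @ex_divisibility_min
    (fun k => sdepth_rank (ideal_module (mideal_pow I k))).
    move=> k s k1 s1; apply: (sdepth_rank_preim (ideal_basis _) (ideal_basis _) s1).
    by move=> m; apply: ideal_mon_pow.
  by exists k; split=> // s /hk/sdepth_rank_inj.
have [|k [k1 hk]] := @ex_divisibility_min
  (fun k => sdepth_rank (quotient_module (mideal_pow I k))).
  move=> k s k1 s1.
  apply: (sdepth_rank_preim (quotient_basis _) (quotient_basis _) s1).
  (* The equivalence for exponents in the ideals passes to their complements by negation. *)
  by move=> m; congr negb; apply: ideal_mon_pow.
by exists k; split=> // s /hk/sdepth_rank_inj.
Qed.
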